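(* Let $\{\mathfrak{n}_0=U\oplus\mathfrak{g}_0,\langle\,,\rangle\}$ be the real 2-step nilpotent Lie algebra described in the context. If $u\in U$, then $\mathrm{im}(\mathrm{ad}\,u)=\mathfrak{g}_{0,u}^{\perp}$, where $\mathrm{ad}\,u:\mathfrak{n}_0\to\mathfrak{g}_0$, $\xi\mapsto[u,\xi]$, is taken in $\mathfrak{n}_0$, $\mathfrak{g}_{0,u}=\{X\in\mathfrak{g}_0:X(u)=0\}$ and $\mathfrak{g}_{0,u}^{\perp}=\{X\in\mathfrak{g}_0:\langle X,Y\rangle=0\text{ for all }Y\in\mathfrak{g}_{0,u}\}$.
   Context: $\mathfrak{g}_0$ is a compact semisimple real Lie algebra (negative definite Killing form), $U$ a finite dimensional real $\mathfrak{g}_0$-module. $\langle\,,\rangle$ is a positive definite inner product on $\mathfrak{n}_0=U\oplus\mathfrak{g}_0$ such that $U\perp\mathfrak{g}_0$, every $X\in\mathfrak{g}_0$ acts skew symmetrically on $U$, and $\mathrm{ad}X:\mathfrak{g}_0\to\mathfrak{g}_0$ (adjoint representation of $\mathfrak{g}_0$) is skew symmetric for every $X\in\mathfrak{g}_0$. The bracket of $\mathfrak{n}_0$ is defined by: $\mathfrak{g}_0$ is central in $\mathfrak{n}_0$, $[\mathfrak{n}_0,\mathfrak{n}_0]\subseteq\mathfrak{g}_0$, and $\langle[u,u'],Z\rangle=\langle Z(u),u'\rangle$ for $u,u'\in U$, $Z\in\mathfrak{g}_0$. *)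

(* Defs.v *)
From HB Require Import structures.
From mathcomp Require Import all_boot all_order all_algebra.
From mathcomp Require Import all_classical reals.

Set Implicit Arguments.
Unset Strict Implicit.
Unset Printing Implicit Defensive.

Import Order.TTheory GRing.Theory Num.Theory.
Local Open Scope classical_set_scope.
Local Open Scope ring_scope.

Definition is_lie_bracket (R : nzRingType) (L : lmodType R)
    (br : {bilinear L -> L -> L}) : Prop :=
  (forall x, br x x = 0) /\
  (forall x y z, br x (br y z) + br y (br z x) + br z (br x y) = 0).

Definition is_lie_module (R : nzRingType) (g U : lmodType R)
    (br : {bilinear g -> g -> g}) (act : {bilinear g -> U -> U}) : Prop :=
  forall X Y u, act (br X Y) u = act X (act Y u) - act Y (act X u).

Definition lfun_trace (R : fieldType) (V : vectType R) (f : 'End(V)) : R :=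
  \tr (passmx.mxof (vbasis {:V}) (vbasis {:V}) f).

Definition killing (R : fieldType) (g : vectType R)
    (br : {bilinear g -> g -> g}) (X Y : g) : R :=
  lfun_trace (linfun (br X) \o linfun (br Y))%VF.

Definition compact_semisimple (R : realType) (g : vectType R)
    (br : {bilinear g -> g -> g}) : Prop :=
  forall X, X != 0 -> killing br X X < 0.

Section TwoStep.
Variables (R : realType) (U g : vectType R).
Implicit Types (act : {bilinear g -> U -> U}) (ip : {dot (U * g)%type for idfun}).
Implicit Types (brn : {bilinear (U * g)%type -> (U * g)%type -> (U * g)%type}).

(* U and g sit in U * g through u |-> (u, 0) and X |-> (0, X). *)

Definition orthogonal_summands ip : Prop :=
  forall (u : U) (X : g), ip (u, 0) (0, X) = 0.

Definition acts_skew act ip : Prop :=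
  forall X (u v : U), ip (act X u, 0) (v, 0) = - ip (u, 0) (act X v, 0).

Definition ad_skew (br : {bilinear g -> g -> g}) ip : Prop :=
  forall X Y Z : g, ip (0, br X Y) (0, Z) = - ip (0, Y) (0, br X Z).

(* These conditions determine brn uniquely; such a bracket always exists, see
   [two_step_bracket_exists]. *)
Definition is_two_step_bracket act ip brn : Prop :=
  [/\ is_lie_bracket brn,
      forall (X : g) xi, brn (0, X) xi = 0,
      forall xi eta, (brn xi eta).1 = 0 &
      forall (u u' : U) (Z : g),
        ip (brn (u, 0) (u', 0)) (0, Z) = ip (act Z u, 0) (u', 0)].

(* The values of brn have zero U-component, so the projection on g only
   restricts the codomain. *)
Definition ad_g brn (u : U) (xi : U * g) : g := (brn (u, 0) xi).2.

Definition stabilizer act (u : U) : set g := [set X | act X u = 0].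

Definition g_ortho ip (A : set g) : set g :=
  [set X | forall Y, A Y -> ip (0, X) (0, Y) = 0].

End TwoStep.

Lemma two_step_bracket_exists (R : realType) (U g : vectType R)
    (act : {bilinear g -> U -> U}) (ip : {dot (U * g)%type for idfun}) :
  acts_skew act ip ->
  exists brn : {bilinear (U * g)%type -> (U * g)%type -> (U * g)%type},
    is_two_step_bracket act ip brn.
Proof.
move=> skew; pose n := (U * g)%type.
have inrP a (X Y : g) : (0, a *: X + Y) = a *: (0, X) + (0, Y) :> n.
  by rewrite /GRing.scale /= /GRing.add /= /scale_pair /add_pair /= scaler0 addr0.
have inlP a (X Y : U) : (a *: X + Y, 0) = a *: (X, 0) + (Y, 0) :> n.
  by rewrite /GRing.scale /= /GRing.add /= /scale_pair /add_pair /= scaler0 addr0.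
have ipC (x y : n) : ip x y = ip y x by rewrite hermC expr0 mul1r.
have ipPr (z : n) a x y : ip z (a *: x + y) = a * ip z x + ip z y.
  by rewrite linearDr linearZr.
have ipPl (z : n) a x y : ip (a *: x + y) z = a * ip x z + ip y z.
  by rewrite ipC ipPr !(ipC z).
pose f X : 'Hom(g, R^o) := linfun (fun Y : g => ip (0, X) (0, Y) : R^o).
have fE X Y : f X Y = ip (0, X) (0, Y).
  pose h (Y : g) : R^o := ip (0, X) (0, Y).
  have hl : linear h by move=> a x y; rewrite /h inrP ipPr.
  pose hM := GRing.isLinear.Build R g R^o _ h hl.
  pose hL : {linear g -> R^o} := HB.pack h hM.
  by rewrite (lfunE hL Y).
have fl : linear f.
  by move=> a x y; apply/lfunP => Z; rewrite !lfunE /= !lfunE /= !fE inrP ipPl.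
pose fM := GRing.isLinear.Build R g 'Hom(g, R^o) _ f fl.
pose fL : {linear g -> 'Hom(g, R^o)} := HB.pack f fM.
pose phi := linfun fL.
have phiE X Y : phi X Y = ip (0, X) (0, Y) by rewrite lfunE /= fE.
have phi0 : lker phi == 0%VS.
  apply/lker0P => X Y eXY; apply/eqP; rewrite -subr_eq0; apply/negP => /negP nz.
  have /neq0_dnorm_gt0 : (0, X - Y) != 0 :> n.
    by apply: contra nz => /eqP [->].
  have e Z : ip (0, X) (0, Z) = ip (0, Y) (0, Z) by rewrite -!phiE eXY.
  move/(_ idfun ip); rewrite {1}(_ : X - Y = (-1) *: Y + X) ?inrP ?ipPl ?e.
    by rewrite mulN1r addNr ltxx.
  by rewrite scaleN1r addrC.
have phiK v : phi ((phi^-1)%VF v) = v.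
  apply: limg_lfunVK; suff -> : limg phi = fullv by apply: memvf.
  apply/eqP; rewrite eqEdim subvf /= limg_dim_eq ?(eqP phi0) ?capv0 //.
  by rewrite !dimvf /dim /= muln1.
pose b (x y : U) : 'Hom(g, R^o) :=
  linfun (fun Z : g => ip (act Z x, 0) (y, 0) : R^o).
have bE x y Z : b x y Z = ip (act Z x, 0) (y, 0).
  pose h (Z : g) : R^o := ip (act Z x, 0) (y, 0).
  have hl : linear h by move=> a X Y; rewrite /h linearDl linearZl inlP ipPl.
  pose hM := GRing.isLinear.Build R g R^o _ h hl.
  pose hL : {linear g -> R^o} := HB.pack h hM.
  by rewrite (lfunE hL Z).
pose B (xi eta : n) : n := (0, (phi^-1)%VF (b xi.1 eta.1)).
have Bl : bilinear_for *:%R *:%R B.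
  split=> [e | xi] a x y; rewrite /B -inrP -linearP /=;
    congr (_, fun_of_lfun _ _); apply/lfunP => Z; rewrite !lfunE /= !lfunE /= !bE.
    by rewrite linearDr linearZr /= inlP ipPl.
  by rewrite inlP ipPr.
pose BM := bilinear_isBilinear.Build R n n n _ _ B Bl.
pose BL : {bilinear n -> n -> n} := HB.pack B BM.
have b0 u : b u u = 0.
  apply/lfunP => Z; rewrite lfunE bE.
  by apply/eqP; rewrite -eqNr; apply/eqP; rewrite {1}(skew Z) opprK ipC.
have b0l y : b 0 y = 0.
  by apply/lfunP => Z; rewrite lfunE bE linear0 -[(0, 0)]/(0 : n) linear0l.
have b0r x : b x 0 = 0.
  by apply/lfunP => Z; rewrite lfunE bE -[(0, 0)]/(0 : n) linear0r.
have BLE xi eta : BL xi eta = (0, (phi^-1)%VF (b xi.1 eta.1)) by [].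
exists BL; split=> [|X xi|//|u u' Z]; last by rewrite BLE -phiE phiK bE.
  split=> [x|x y z]; rewrite !BLE ?b0 ?b0r ?linear0 //.
  by rewrite -[(0, 0)]/(0 : n) !addr0.
by rewrite BLE b0l linear0.
Qed.

(* Main.v *)
From HB Require Import structures.
Require Import Defs.
From mathcomp Require Import all_boot all_order all_algebra.
From mathcomp Require Import all_classical reals.

(** Fix u in U and consider the endomorphism f : Y |-> [u, Y(u)] of g. The
    definition of the bracket gives <f Y, Z> = <Z(u), Y(u)>: so f is the Gram
    operator A^*A of the evaluation map A : Y |-> Y(u). It follows that f is
    self-adjoint and, by positivity, that its kernel is the kernel of A, which
    is the stabilizer g_u of u.

    A self-adjoint operator satisfies ker f^2 = ker f, because
    <f X, f X> = <f (f X), X>, and hence g = ker f + im f by dimension count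
    ([mem_ker_add_img]). If X is orthogonal to g_u, write X = k + f Y with k in
    g_u; then <k, k> = <X, k> - <f Y, k> = 0 - <k(u), Y(u)> = 0, and thus
    X = [u, Y(u)] lies in im (ad u). Conversely, <[u, v], Y> = <Y(u), v>
    vanishes for v in U and Y in g_u ([ad_g_range_subset]). *)

Set Implicit Arguments.
Unset Strict Implicit.
Unset Printing Implicit Defensive.

Import Order.TTheory GRing.Theory Num.Theory.
Local Open Scope classical_set_scope.
Local Open Scope ring_scope.

(** The hypothesis says that ker f and im f meet trivially, so by rank-nullity
    they span the whole space. *)
Lemma mem_ker_add_img (F : fieldType) (V : vectType F) (f : 'End(V)) :
    (forall x, f (f x) = 0 -> f x = 0) ->
  forall x, exists k y, f k = 0 /\ x = k + f y.
Proof.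
move=> ff0 x.
have dxf : (lker f :&: limg f = 0)%VS.
  apply/eqP; rewrite -subv0; apply/subvP => z; rewrite memv_cap memv0.
  by case/andP => /[swap] /memv_imgP[y _ ->]; rewrite memv_ker => /eqP/ff0->.
have full : (lker f + limg f = fullv)%VS.
  apply/eqP; rewrite eqEdim subvf /= dimv_disjoint_sum //.
  by rewrite -(limg_ker_dim f fullv) capfv.
have : x \in (lker f + limg f)%VS by rewrite full memvf.
case/memv_addP => k; rewrite memv_ker => /eqP fk [_ /memv_imgP[y _ ->] ->].
by exists k, y.
Qed.

Section DotProduct.
Variables (R : realType) (V : vectType R) (ip : {dot V for idfun}).

Lemma dotC (x y : V) : ip x y = ip y x.
Proof. by rewrite hermC expr0 mul1r. Qed.

Lemma dot_self_eq0 (x : V) : ip x x = 0 -> x = 0.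
Proof.
move=> xx0; apply/eqP/negPn/negP => /neq0_dnorm_gt0.
by move/(_ idfun ip); rewrite xx0 ltxx.
Qed.

End DotProduct.

Section TwoStep.
Variables (R : realType) (g U : vectType R) (act : {bilinear g -> U -> U}).
Variables (ip : {dot (U * g)%type for idfun}).
Variables (brn : {bilinear (U * g)%type -> (U * g)%type -> (U * g)%type}).
Hypothesis brn_def : is_two_step_bracket act ip brn.

Lemma dot_inrDl (X Y Z : g) :
  ip (0, X + Y) (0, Z) = ip (0, X) (0, Z) + ip (0, Y) (0, Z).
Proof.
rewrite -linearDl; congr (ip _ _).
by rewrite /GRing.add /= /add_pair /= addr0.
Qed.

(** The g-component of the argument drops out because g is central. The
    vanishing [X, xi] = 0 is transported to [(u, 0), X] = 0 by expanding the
    square of (u, 0) + (0, X) with the alternating bracket. *)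
Lemma ad_gE (u : U) (xi : U * g) : ad_g brn u xi = ad_g brn u (xi.1, 0).
Proof.
case: brn_def => -[brnn _] brn0 _ _; case: xi => v X /=; rewrite /ad_g.
have -> : (v, X) = (v, 0) + (0, X) :> U * g.
  by rewrite /GRing.add /= /add_pair /= addr0 add0r.
rewrite linearDr /=.
have : brn ((u, 0) + (0, X)) ((u, 0) + (0, X)) = 0 by exact: brnn.
by rewrite linearDl !linearDr /= !brnn !brn0 add0r !addr0 => ->; rewrite addr0.
Qed.

Lemma dot_ad_g (u : U) (xi : U * g) (Z : g) :
  ip (0, ad_g brn u xi) (0, Z) = ip (act Z u, 0) (xi.1, 0).
Proof.
case: brn_def => _ _ brn1 brnE; rewrite ad_gE -brnE; congr (ip _ _).
by rewrite [RHS]surjective_pairing brn1.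
Qed.

Lemma ad_g_range_subset (u : U) :
  range (ad_g brn u) `<=` g_ortho ip (stabilizer act u).
Proof.
move=> _ [xi _ <-] Y /= Yu; rewrite dot_ad_g Yu.
exact: linear0l.
Qed.

(** In terms of the evaluation map A : Y |-> Y(u) this is A^*A, since
    v |-> [u, v] is the adjoint of A by [dot_ad_g]. *)
Definition gram (u : U) (Y : g) : g := ad_g brn u (act Y u, 0).

Lemma gram_is_linear (u : U) : linear (gram u).
Proof.
move=> a X Y; rewrite /gram /ad_g linearDl linearZl /=.
have -> : (a *: act X u + act Y u, 0) =
          a *: (act X u, 0) + (act Y u, 0) :> U * g.
  by rewrite /GRing.scale /= /GRing.add /= /scale_pair /add_pair /= scaler0 addr0.
by rewrite linearDr linearZr.
Qed.

HB.instance Definition _ u :=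
  GRing.isLinear.Build R g g *:%R (gram u) (gram_is_linear u).

Lemma dot_gram (u : U) (Y Z : g) :
  ip (0, gram u Y) (0, Z) = ip (act Z u, 0) (act Y u, 0).
Proof. exact: dot_ad_g. Qed.

Lemma gram_self_adjoint (u : U) (Y Z : g) :
  ip (0, gram u Y) (0, Z) = ip (0, gram u Z) (0, Y).
Proof. by rewrite !dot_gram dotC. Qed.

Lemma gram_eq0 (u : U) (Y : g) : gram u Y = 0 -> act Y u = 0.
Proof.
move=> fY0; have := dot_gram u Y Y; rewrite fY0 (_ : ip _ _ = 0).
  by move/esym/dot_self_eq0 => -[].
exact: linear0l.
Qed.

Lemma gram_gram_eq0 (u : U) (Y : g) : gram u (gram u Y) = 0 -> gram u Y = 0.
Proof.
move=> ffY0; suff /dot_self_eq0[] : ip (0, gram u Y) (0, gram u Y) = 0 by [].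
by rewrite gram_self_adjoint ffY0; exact: linear0l.
Qed.

Lemma g_ortho_subset_range (u : U) :
  g_ortho ip (stabilizer act u) `<=` range (ad_g brn u).
Proof.
move=> X Xorth.
have [k [Y []]] : exists k Y, linfun (gram u) k = 0 /\ X = k + linfun (gram u) Y.
  by apply: mem_ker_add_img => Z; rewrite !lfunE; exact: gram_gram_eq0.
rewrite !lfunE /= => /gram_eq0 ku XE.
suff k0 : k = 0 by exists (act Y u, 0) => //; rewrite XE k0 add0r.
have := Xorth k ku; rewrite XE dot_inrDl dot_gram ku.
rewrite [X in _ + X](_ : _ = 0) ?addr0; last exact: linear0l.
by move/dot_self_eq0 => -[].
Qed.

End TwoStep.

Theorem proposition6p11 (R : realType) (g U : vectType R)
    (br : {bilinear g -> g -> g}) (act : {bilinear g -> U -> U})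
    (ip : {dot (U * g)%type for idfun})
    (brn : {bilinear (U * g)%type -> (U * g)%type -> (U * g)%type})
    (br_lie : is_lie_bracket br) (br_compact : compact_semisimple br)
    (act_module : is_lie_module br act)
    (ip_orth : orthogonal_summands ip)
    (ip_act : acts_skew act ip) (ip_ad : ad_skew br ip)
    (brn_def : is_two_step_bracket act ip brn) (u : U) :
  range (ad_g brn u) = g_ortho ip (stabilizer act u).
Proof.
apply/seteqP; split; first exact: ad_g_range_subset.
exact: g_ortho_subset_range.
Qed.
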